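(* Let $D$ be a division ring with infinite center $F$, let $n\geq 3$ be an integer, and let $p\in F[x]$ be a nonconstant polynomial. Then every matrix in $\mathrm{M}_n(D)$ can be expressed as a product of three elements of $p[\mathrm{M}_n(D),\mathrm{M}_n(D)]=\{p(AB)-p(BA)\mid A,B\in\mathrm{M}_n(D)\}$. *)

(* Defs.v *)
From mathcomp Require Import all_boot all_order all_algebra.
Set Implicit Arguments. Unset Strict Implicit. Unset Printing Implicit Defensive.
Import GRing.Theory.
Local Open Scope ring_scope.

Definition central (R : nzRingType) (x : R) : Prop := forall y : R, x * y = y * x.

(* R is a division ring: every nonzero element is invertible
   (nontriviality 1 != 0 is part of unitRingType). *)
Definition division_ring (R : unitRingType) : Prop :=
  forall x : R, x != 0 -> x \is a GRing.unit.

Definition infinite_center (R : nzRingType) : Prop :=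
  forall s : seq R, exists x : R, central x /\ x \notin s.

Definition mxpeval (R : nzRingType) (n : nat) (p : {poly R}) (M : 'M[R]_n)
  : 'M[R]_n :=
  \sum_(i < size p) ((p`_i)%:M *m (M ^+ i)).

Definition pcomm (R : nzRingType) (n : nat) (p : {poly R}) (A B : 'M[R]_n)
  : 'M[R]_n :=
  mxpeval p (A *m B) - mxpeval p (B *m A).

(* Main.v *)
Require Import Defs.
From mathcomp Require Import all_boot all_order all_algebra.
Set Implicit Arguments. Unset Strict Implicit. Unset Printing Implicit Defensive.
Import GRing.Theory.
Local Open Scope ring_scope.

(* If A is invertible then p(AB) - p(BA) = p(C) - p(A^-1 C A) with C = AB, so
   the differences P - Q of two similar matrices in the image of p all belong to
   p[M_n(D), M_n(D)], a set which is closed under similarity.  Since the center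
   is infinite, some central l_0, ..., l_(n-1) have distinct images under p, and
   every triangular matrix with diagonal p(l_0), ..., p(l_(n-1)) is similar to
   p(diag(l)).  Hence every matrix similar to one with zero diagonal is in
   p[M_n(D), M_n(D)], and it suffices to factor M into three such matrices.
   Cyclic shifts handle scalar M.  Otherwise M is similar to some M' whose i-th
   column is 0 at i and 1 elsewhere; subtracting from each column k the multiple
   M'_kk of the i-th one clears the diagonal, so M' = Y N with Y of zero
   diagonal and N = 1 - e_i x a transvection.  Up to similarity N_ij = 0 for some
   j <> i, so N times the cyclic shift by i - j has zero diagonal. *)

(** * Central elements with distinct values under [p] *)

Lemma central_uniq_seq (D : nzRingType) k :
  infinite_center D ->
  exists r : seq D, [/\ size r = k, uniq r & {in r, forall x, central x}].
Proof.
move=> infF; elim: k => [|k [r [size_r uniq_r central_r]]]; first by exists [::].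
have [x [cx xr]] := infF r; exists (x :: r).
split=> [||y]; rewrite /= ?size_r ?xr // inE.
by case/predU1P=> [->|/central_r].
Qed.

(** Distinct central elements commute and have invertible differences, so fewer than [size q] of
    them are roots of [q]. *)
Lemma central_nonroot (D : unitRingType) (q : {poly D}) :
  division_ring D -> infinite_center D -> q != 0 ->
  exists x, central x /\ ~~ root q x.
Proof.
move=> divD infF q_neq0.
have [r [size_r uniq_r central_r]] := central_uniq_seq (size q) infF.
have uroots: uniq_roots r.
  elim: r uniq_r central_r {size_r} => //= x r IHr /andP[xr uniq_r] central_r.
  rewrite IHr // ?andbT => [|y yr]; last by apply: central_r; rewrite inE yr orbT.
  apply/allP=> y yr; rewrite /diff_roots central_r ?mem_head // eqxx /=.
  by apply: divD; rewrite subr_eq0; apply: contraNneq xr => <-.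
have: ~~ all (root q) r.
  by apply/negP=> /(max_ring_poly_roots q_neq0)/(_ uroots); rewrite size_r ltnn.
by case/allPn=> x /central_r cx ?; exists x.
Qed.

(** The product of the [p - c] for [c] in [s] works, since evaluation at a central point is
    multiplicative. *)
Lemma central_values_poly (D : unitRingType) (p : {poly D}) (s : seq D) :
  division_ring D -> (1 < size p)%N ->
  exists2 q : {poly D}, q != 0
    & forall x, central x -> p.[x] \in s -> root q x.
Proof.
move=> divD p_gt1; elim: s => [|c s [q q_neq0 rootq]].
  by exists 1; rewrite ?oner_eq0.
have lt_c: (size (- c%:P : {poly D}) < size p)%N.
  by rewrite size_polyN (leq_ltn_trans (size_polyC_leq1 c)).
(* [p - c] keeps the leading coefficient of [p], which is a unit. *)
have lpc: lead_coef (p - c%:P) * lead_coef q != 0.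
  rewrite lead_coefDl // mulrI_eq0 ?lead_coef_eq0 //.
  by apply: mulrI; apply: divD; rewrite lead_coef_eq0 -size_poly_gt0 ltnW.
exists ((p - c%:P) * q) => [|x cx].
  by rewrite -lead_coef_eq0 lead_coef_proper_mul.
rewrite inE rootE hornerM_comm; last by rewrite /comm_poly cx.
rewrite hornerD hornerN hornerC; case/predU1P => [->|/(rootq x cx)/eqP->].
  by rewrite subrr mul0r.
by rewrite mulr0.
Qed.

Lemma central_distinct_values (D : unitRingType) (p : {poly D}) (n : nat) :
  division_ring D -> infinite_center D -> (1 < size p)%N ->
  exists l : 'rV[D]_n,
    (forall i, central (l 0 i)) /\ injective (fun i => p.[l 0 i]).
Proof.
move=> divD infF p_gt1.
have [v [size_v uniq_pv central_v]] : exists v : seq D,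
    [/\ size v = n, uniq (map (horner p) v) & {in v, forall x, central x}].
  elim: n => [|n [v [size_v uniq_pv central_v]]]; first by exists [::].
  (* The next [x] avoids the roots of [q], among which are all central elements that [p] sends to an
     earlier value. *)
  have [q q_neq0 rootq] :=
    central_values_poly (map (horner p) v) divD p_gt1.
  have [x [cx qx]] := central_nonroot divD infF q_neq0.
  exists (x :: v); split=> [||y]; rewrite /= ?size_v ?uniq_pv ?andbT //.
    by apply: contra qx => /rootq->.
  by rewrite inE; case/predU1P=> [->|/central_v].
exists (\row_i v`_i); split=> [i|i j]; rewrite !mxE.
  by apply: central_v; rewrite mem_nth ?size_v.
rewrite -!(nth_map 0 0 (horner p)) ?size_v // => /eqP.
by rewrite nth_uniq ?size_map ?size_v // => /eqP/val_inj.
Qed.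

(** * Similarity and evaluation of [p] at matrices *)

Definition similar_mx (R : nzRingType) n (A B : 'M[R]_n) :=
  exists S S', [/\ S *m S' = 1%:M, S' *m S = 1%:M & B = S *m A *m S'].

Lemma central_scalar_mxC (R : nzRingType) n (a : R) (A : 'M[R]_n) :
  central a -> a%:M *m A = A *m a%:M.
Proof.
by move=> ca; rewrite -diag_const_mx mul_diag_mx mul_mx_diag;
   apply/matrixP=> i j; rewrite !mxE ca.
Qed.

Lemma expmx_conj (R : nzRingType) n (S S' A : 'M[R]_n) k :
  S *m S' = 1%:M -> S' *m S = 1%:M ->
  (S *m A *m S') ^+ k = S *m A ^+ k *m S'.
Proof.
move=> SS' S'S; elim: k => [|k IHk]; first by rewrite !expr0 mulmx1.
by rewrite !exprS IHk -!mulmxE !mulmxA -(mulmxA _ _ S) S'S mulmx1.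
Qed.

Lemma mxpeval_conj (R : nzRingType) n (p : {poly R}) (S S' A : 'M[R]_n) :
  (forall i, central p`_i) -> S *m S' = 1%:M -> S' *m S = 1%:M ->
  mxpeval p (S *m A *m S') = S *m mxpeval p A *m S'.
Proof.
move=> cp SS' S'S; rewrite /mxpeval mulmx_sumr mulmx_suml.
apply: eq_bigr => i _; rewrite expmx_conj // !mulmxA.
by rewrite (central_scalar_mxC _ (cp i)).
Qed.

Lemma mxpeval_diag (R : nzRingType) n (p : {poly R}) (l : 'rV[R]_n) :
  mxpeval p (diag_mx l) = diag_mx (\row_i p.[l 0 i]).
Proof.
have expD k : diag_mx l ^+ k = diag_mx (\row_i (l 0 i ^+ k)).
  elim: k => [|k IHk]; first by apply/matrixP=> i j; rewrite !mxE expr0.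
  rewrite exprS IHk -mulmxE mul_diag_mx.
  by apply/matrixP=> i j; rewrite !mxE mulrnAr exprS.
apply/matrixP=> i j; rewrite summxE !mxE horner_coef -sumrMnl.
by apply: eq_bigr => k _; rewrite expD mul_scalar_mx !mxE mulrnAr.
Qed.

Lemma pcomm_conj (R : nzRingType) n (p : {poly R}) (S S' A B : 'M[R]_n) :
  (forall i, central p`_i) -> S *m S' = 1%:M -> S' *m S = 1%:M ->
  S *m pcomm p A B *m S' = pcomm p (S *m A *m S') (S *m B *m S').
Proof.
move=> cp SS' S'S; rewrite /pcomm mulmxBr mulmxBl -!mxpeval_conj // !mulmxA.
by do 2!rewrite -[in RHS](mulmxA _ S' S) S'S mulmx1.
Qed.

Lemma similar_pcomm (R : nzRingType) n (p : {poly R}) (A B : 'M[R]_n) :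
  (forall i, central p`_i) -> similar_mx A B ->
  exists C1 C2, mxpeval p A - mxpeval p B = pcomm p C1 C2.
Proof.
move=> cp [S [S' [SS' S'S ->]]].
(* These two matrices multiply to [A] in this order and to [S A S'] in the other. *)
exists (A *m S'), S; rewrite /pcomm -[in RHS]mulmxA S'S mulmx1.
by rewrite mulmxA.
Qed.

Lemma similar_mx_sym (R : nzRingType) n (A B : 'M[R]_n) :
  similar_mx A B -> similar_mx B A.
Proof.
move=> [S [S' [SS' S'S ->]]]; exists S', S; split=> //.
by rewrite !mulmxA S'S mul1mx -mulmxA S'S mulmx1.
Qed.

Lemma similar_mx_trans (R : nzRingType) n (B A C : 'M[R]_n) :
  similar_mx A B -> similar_mx B C -> similar_mx A C.
Proof.
move=> [S [S' [SS' S'S ->]]] [T [T' [TT' T'T ->]]].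
exists (T *m S), (S' *m T'); rewrite !mulmxA; split=> //.
  by rewrite -(mulmxA T) SS' mulmx1.
by rewrite -(mulmxA S') T'T mulmx1.
Qed.

Lemma similar_mx_mxsub (R : nzRingType) n (f : 'I_n -> 'I_n) (A B : 'M[R]_n) :
  bijective f -> similar_mx A B -> similar_mx (mxsub f f A) (mxsub f f B).
Proof.
move=> bij_f [S [S' [SS' S'S ->]]].
have mxsubM (X Y : 'M[R]_n) :
    mxsub f f (X *m Y) = mxsub f f X *m mxsub f f Y.
  apply/matrixP=> i j; rewrite !mxE (reindex f) /=; last exact: onW_bij.
  by apply: eq_bigr => k _; rewrite !mxE.
have mxsub1 : mxsub f f 1%:M = 1%:M :> 'M[R]_n.
  by apply/matrixP=> i j; rewrite !mxE (bij_eq bij_f).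
by exists (mxsub f f S), (mxsub f f S'); rewrite -!mxsubM SS' S'S mxsub1.
Qed.

(** * Triangular matrices and matrices with zero diagonal *)

(* Solve [(diag_mx d + U) S = S diag_mx d] for a unitriangular [S]: the entries
   of its first row come from dividing by the central units [d_j - d_0]. *)
Lemma upper_similar_diag (D : unitRingType) n (d : 'rV[D]_n) (A : 'M[D]_n) :
  division_ring D -> (forall i, central (d 0 i)) -> injective (d 0) ->
  (forall i j : 'I_n, (j < i)%N -> A i j = 0) -> (forall i, A i i = d 0 i) ->
  similar_mx A (diag_mx d).
Proof.
move=> divD; elim: n d A => [|n IHn] d A cd inj_d upA diagA.
  by exists 1%:M, 1%:M; rewrite !mulmx1; split=> //; apply/matrixP=> -[].
apply: similar_mx_sym.
move: d A cd inj_d upA diagA; rewrite -[n.+1]/(1 + n)%N => d A cd inj_d upA diagA.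
set u := ursubmx A; set c := lsubmx d 0 0; set e := rsubmx d.
have [|||| S [S' [SS' S'S defA]]] // := IHn e (drsubmx A).
- by move=> i; rewrite mxE.
- by move=> i j; rewrite !mxE => /inj_d/rshift_inj.
- by move=> i j ltji; rewrite !mxE upA.
- by move=> i; rewrite !mxE diagA.
have {}defA : drsubmx A *m S' = S' *m diag_mx e.
  by rewrite defA -!mulmxA mulmxA S'S mul1mx.
(* The upper right block requires [c y + u S' = y e]; as [c] is central, entry [j] reads
   [y_j (e_j - c) = (u S')_j]. *)
pose y := \row_j ((u *m S') 0 j / (e 0 j - c)).
have {}IHn : c%:M *m y + u *m S' = y *m diag_mx e.
  apply/rowP=> j; rewrite mul_mx_diag mul_scalar_mx mxE.
  have unit_ec : e 0 j - c \is a GRing.unit.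
    apply: divD; rewrite subr_eq0 /c !mxE (inj_eq inj_d).
    by rewrite eq_rlshift.
  have <- : y 0 j * (e 0 j - c) = (u *m S') 0 j by rewrite mxE mulrVK.
  by rewrite mulrBr /c !mxE cd addrC subrK.
exists (block_mx 1%:M y 0 S'), (block_mx 1%:M (- (y *m S)) 0 S).
rewrite !mulmx_block !(mulmx1, mul1mx, mul0mx, mulmx0, addr0, add0r).
split.
- by rewrite S'S scalar_mx_block addNr.
- by rewrite SS' mulNmx -mulmxA SS' mulmx1 subrr scalar_mx_block.
have -> : diag_mx d = block_mx c%:M 0 0 (diag_mx e).
  rewrite -[d in LHS]hsubmxK diag_mx_row; congr block_mx.
  by apply/matrixP=> i j; rewrite !ord1 /c !mxE.
rewrite !mulmx_block !(mulmx1, mul1mx, mul0mx, mulmx0, addr0, add0r).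
rewrite -IHn -defA mulmxDl mulmxN -!mulmxA S'S !mulmx1.
rewrite addrA addNr add0r -[LHS]submxK; congr block_mx.
  by apply/matrixP=> i j; rewrite !ord1 /c !mxE diagA.
by apply/matrixP=> i j; rewrite !mxE upA //= ord1 ltn_addr.
Qed.

Lemma central_horner (R : nzRingType) (p : {poly R}) (x : R) :
  (forall i, central p`_i) -> central x -> central p.[x].
Proof.
move=> cp cx y; apply: commr_sym; rewrite horner_coef; apply: commr_sum => i _.
by apply: commrM; [|apply: commrX]; apply: commr_sym; [apply: cp|apply: cx].
Qed.

Lemma similar_mxpeval (R : nzRingType) n (p : {poly R}) (A B : 'M[R]_n) :
  (forall i, central p`_i) -> similar_mx (mxpeval p A) B ->
  exists2 C, similar_mx A C & B = mxpeval p C.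
Proof.
move=> cp [S [S' [SS' S'S ->]]]; exists (S *m A *m S'); first by exists S, S'.
by rewrite mxpeval_conj.
Qed.

(* A matrix with zero diagonal is [P - Q] with [P] upper triangular, [Q] lower
   triangular and both having the diagonal [p(l_0), ..., p(l_(n-1))]. *)
Lemma zero_diag_pcomm (D : unitRingType) n (p : {poly D}) (Z : 'M[D]_n) :
  division_ring D -> infinite_center D -> (forall i, central p`_i) ->
  (1 < size p)%N -> (forall i, Z i i = 0) -> exists A B, Z = pcomm p A B.
Proof.
move=> divD infF cp p_gt1 Z0.
have [l [cl inj_pl]] := central_distinct_values n divD infF p_gt1.
pose d := \row_i p.[l 0 i].
have cd i : central (d 0 i) by rewrite mxE; apply: central_horner.
have inj_d : injective (d 0) by move=> i j; rewrite !mxE => /inj_pl.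
pose P := \matrix_(i, j) (if (i < j)%N then Z i j else d 0 i *+ (i == j)).
pose Q := P - Z.
have simP : similar_mx P (diag_mx d).
  apply: upper_similar_diag => // [i j ltji|i]; rewrite mxE.
    by rewrite ltnNge ltnW //= -val_eqE gtn_eqF.
  by rewrite ltnn eqxx.
have simQ : similar_mx Q (diag_mx d).
  (* Reversing the order of the indices makes the lower triangular [Q] upper triangular. *)
  pose rev := @rev_ord n; have revK : involutive rev := @rev_ordK n.
  have bij_rev : bijective rev := inv_bij revK.
  have mxsubK (A : 'M[D]_n) : mxsub rev rev (mxsub rev rev A) = A.
    by apply/matrixP=> i j; rewrite !mxE !revK.
  rewrite -[Q]mxsubK -[diag_mx d]mxsubK; apply: similar_mx_mxsub => //.
  have -> : mxsub rev rev (diag_mx d) =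
            diag_mx (\row_i d 0 (rev i)).
    by apply/matrixP=> i j; rewrite !mxE (inj_eq rev_ord_inj).
  apply: upper_similar_diag => // [i|i j|i j ltji|i].
  - by rewrite mxE.
  - by rewrite [LHS]mxE [RHS]mxE => /inj_d/rev_ord_inj.
  - by rewrite !mxE /= ltn_sub2lE // ltnS ltji subrr.
  - by rewrite !mxE ltnn eqxx Z0 subr0.
(* Now [P] and [Q] are similar to [p] of [diag_mx l], so they are values of [p] at two conjugates of
   [diag_mx l]. *)
rewrite -mxpeval_diag in simP simQ.
have [X simX defP] := similar_mxpeval cp (similar_mx_sym simP).
have [Y simY defQ] := similar_mxpeval cp (similar_mx_sym simQ).
have -> : Z = mxpeval p X - mxpeval p Y by rewrite -defP -defQ opprB addrC subrK.
exact/(similar_pcomm cp)/(similar_mx_trans (similar_mx_sym simX)).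
Qed.

(** * Matrices similar to one with zero diagonal, and cyclic shifts *)

Definition hollow_like (R : nzRingType) n (M : 'M[R]_n) :=
  exists2 Z : 'M[R]_n, similar_mx Z M & forall i, Z i i = 0.

Lemma zero_diag_hollow_like (R : nzRingType) n (Z : 'M[R]_n) :
  (forall i, Z i i = 0) -> hollow_like Z.
Proof.
by move=> Z0; exists Z => //; exists 1%:M, 1%:M; rewrite !mulmx1 mul1mx.
Qed.

Lemma hollow_like_conj (R : nzRingType) n (S S' M : 'M[R]_n) :
  S *m S' = 1%:M -> S' *m S = 1%:M -> hollow_like M ->
  hollow_like (S *m M *m S').
Proof.
move=> SS' S'S [Z simZ Z0]; exists Z => //; apply: similar_mx_trans simZ _.
by exists S, S'.
Qed.

(** Index addition is modulo [n.+1], so this is a cyclic permutation matrix, with inverse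
    [shift_mx R (- c)]. *)
Definition shift_mx (R : nzRingType) n (c : 'I_n.+1) : 'M[R]_n.+1 :=
  \matrix_(i, j) (j == i + c)%:R.

Lemma mul_mx_shift (R : nzRingType) n (c : 'I_n.+1) (A : 'M[R]_n.+1) i j :
  (A *m shift_mx R c) i j = A i (j - c).
Proof.
rewrite mxE (bigD1 (j - c)) //= mxE subrK eqxx mulr1 big1 ?addr0 // => k.
by rewrite mxE eq_sym -subr_eq eq_sym => /negPf->; rewrite mulr0.
Qed.

Lemma shift_mx_hollow (R : nzRingType) n (c : 'I_n.+1) :
  c != 0 -> hollow_like (shift_mx R c).
Proof.
move=> c0; apply: zero_diag_hollow_like => i.
by rewrite mxE -[X in X == _]addr0 (inj_eq (addrI i)) eq_sym (negPf c0).
Qed.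

(** Multiplying by the shift by [- c] moves the vanishing cyclic diagonal of [N] onto the main
    one. *)
Lemma hollow_like_mul2 (R : nzRingType) n (c : 'I_n.+1) (N : 'M[R]_n.+1) :
  c != 0 -> (forall i, N i (i + c) = 0) ->
  exists X Y, [/\ hollow_like X, hollow_like Y & N = X *m Y].
Proof.
move=> c0 Nc; exists (N *m shift_mx R (- c)), (shift_mx R c); split.
- by apply: zero_diag_hollow_like => i; rewrite mul_mx_shift opprK Nc.
- exact: shift_mx_hollow.
- by apply/matrixP=> i j; rewrite !mul_mx_shift opprK subrK.
Qed.

(** * Transvections and normal forms under similarity *)

(** The product expands to [1 + (v + w + v (x w)) x]. This certifies the inverses of the conjugating
    matrices below. *)
Lemma mul_rank1_mx (R : nzRingType) n (v w : 'cV[R]_n) (x : 'rV[R]_n) :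
  v + w + v *m (x *m w) = 0 -> (1%:M + v *m x) *m (1%:M + w *m x) = 1%:M.
Proof.
move=> vw0; rewrite mulmxDl mul1mx mulmxDr mulmx1 -[RHS]addr0 -addrA.
congr (_ + _); rewrite -[RHS](mul0mx _ x) -vw0 !mulmxDl !mulmxA addrCA addrA.
by rewrite -!addrA.
Qed.

Lemma scalar_or_similar_offdiag (R : nzRingType) n (M : 'M[R]_n.+1) :
  (exists a, M = a%:M) \/
  exists M' i j, [/\ similar_mx M M', i != j & M' i j != 0].
Proof.
have [/existsP[i /existsP[j /andP[neij Mij]]] | /existsPn diagM] :=
    boolP [exists i, exists j, (i != j) && (M i j != 0)].
  right; exists M, i, j; split=> //.
  by exists 1%:M, 1%:M; rewrite !mulmx1 mul1mx.
have {}diagM i j : i != j -> M i j = 0.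
  by move=> neij; have /existsPn/(_ j) := diagM i; rewrite neij negbK => /eqP.
have [/forallP eqM | /forallPn[i neM]] := boolP [forall i, M i i == M 0 0].
  left; exists (M 0 0); apply/matrixP=> i j; rewrite mxE.
  by have [<-|/diagM] := eqVneq; rewrite ?(eqP (eqM i)).
right; have i0 : i != 0 by apply: contraNneq neM => ->.
(* Conjugating the diagonal matrix [M] by [1 + v x] creates the entry [M 0 0 - M i i] at position
   [(i, 0)]. *)
pose x : 'rV[R]_n.+1 := delta_mx 0 0; pose v : 'cV[R]_n.+1 := delta_mx i 0.
have xv : x *m v = 0 by rewrite mul_delta_mx_cond eq_sym (negPf i0).
exists ((1%:M + v *m x) *m M *m (1%:M + - v *m x)), i, 0; split=> //.
  exists (1%:M + v *m x), (1%:M + - v *m x).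
  by split=> //; apply: mul_rank1_mx;
    rewrite ?mulNmx ?mulmxN xv mulmx0 oppr0 addr0 ?addrN ?addNr.
have mulS A b : ((1%:M + v *m x) *m A) i b = A i b + A 0 b.
  by rewrite mulmxDl mul1mx -mulmxA -rowE !mxE big_ord1 !mxE !eqxx mul1r.
have mulS' A a : (A *m (1%:M + - v *m x)) a 0 = A a 0 - A a i.
  by rewrite mulmxDr mulmx1 mulNmx mulmxN mulmxA -colE !mxE big_ord1 !mxE mulr1.
have M0i : M 0 i = 0 by apply: diagM; rewrite eq_sym.
by rewrite mulS' !mulS (diagM i 0) // M0i add0r addr0 subr_eq0 eq_sym.
Qed.

(** Conjugate by a matrix that sends column [i] of [M] to the desired column and fixes the basis
    vector [e_i]. *)
Lemma similar_unit_column (D : unitRingType) n (M : 'M[D]_n) (i j : 'I_n) :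
  division_ring D -> j != i -> M j i != 0 ->
  exists2 M', similar_mx M M' & forall k, M' k i = (k != i)%:R.
Proof.
move=> divD neji /divD Mji_unit.
pose u := col i M; pose t : 'cV[D]_n := \col_k (k != i)%:R.
pose x : 'rV[D]_n := delta_mx 0 j.
(* Since [u_j = M j i] and [t_j = 1], [1 + w x] sends [u] to [t] and [1 + w' x] sends [t] to [u];
   both fix [e_i] because [j != i]. *)
pose w := (t - u) *m (M j i)^-1%:M; pose w' := u - t.
have xu : x *m u = (M j i)%:M.
  by apply/matrixP=> a b; rewrite -rowE !ord1 !mxE.
have xt : x *m t = 1%:M.
  by apply/matrixP=> a b; rewrite -rowE !ord1 !mxE neji.
have wxu : w *m (x *m u) = t - u.
  by rewrite xu -mulmxA -scalar_mxM mulVr // mulmx1.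
have xw : x *m w = (M j i)^-1%:M - 1%:M.
  by rewrite mulmxA mulmxBr xt xu mulmxBl mul1mx -scalar_mxM mulrV.
have SS' : (1%:M + w *m x) *m (1%:M + w' *m x) = 1%:M.
  apply: mul_rank1_mx; rewrite /w' mulmxBr xt mulmxBr wxu mulmx1.
  by rewrite -(opprB u t) -opprD [w + _]addrC subrr.
have S'S : (1%:M + w' *m x) *m (1%:M + w *m x) = 1%:M.
  apply: mul_rank1_mx; rewrite xw mulmxBr mulmx1.
  rewrite (_ : w' *m _ = - w); last by rewrite -mulNmx opprB.
  by rewrite -opprD [w + _]addrC subrr.
exists ((1%:M + w *m x) *m M *m (1%:M + w' *m x)).
  by exists (1%:M + w *m x), (1%:M + w' *m x).
suff colM : (1%:M + w *m x) *m M *m (1%:M + w' *m x) *m delta_mx i 0 = t.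
  by move=> k; have := congr1 (fun A : 'cV_n => A k 0) colM; rewrite -colE !mxE.
rewrite -mulmxA (_ : _ *m delta_mx i 0 = delta_mx i 0); last first.
  by rewrite mulmxDl mul1mx -mulmxA mul_delta_mx_cond (negPf neji) mulmx0 addr0.
by rewrite -mulmxA -colE mulmxDl mul1mx -mulmxA wxu addrC subrK.
Qed.

(* A transvection [1 - e_i x] is similar to one with [x_j = 0] for a prescribed
   [j != i]: this needs a third index, hence [3 <= n]. *)
Lemma transvection_hollow2 (D : unitRingType) m (i : 'I_m.+3) (x : 'rV[D]_m.+3) :
  division_ring D -> x 0 i = 0 ->
  exists X Y, [/\ hollow_like X, hollow_like Y
    & 1%:M - delta_mx i 0 *m x = X *m Y].
Proof.
move=> divD xi0.
(* The cyclic diagonal of offset [j - i] meets row [i] in [- z_j = 0] and the other rows in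
   off-diagonal entries of the identity. *)
have hollow_at j (z : 'rV[D]_m.+3) : j != i -> z 0 i = 0 -> z 0 j = 0 ->
  exists X Y, [/\ hollow_like X, hollow_like Y
    & 1%:M - delta_mx i 0 *m z = X *m Y].
  move=> neji zi zj; apply: (@hollow_like_mul2 _ _ (j - i)).
    by rewrite subr_eq0.
  move=> k; rewrite !mxE big_ord1 !mxE.
  have [->|neki] := eqVneq k i.
    by rewrite [i + _]addrC subrK zj mulr0 subr0 eq_sym (negPf neji).
  rewrite mul0r subr0 -[X in X == _]addr0 (inj_eq (addrI k)).
  by rewrite eq_sym subr_eq0 (negPf neji).
have i1 : i + 1 != i by rewrite -[X in _ != X]addr0 (inj_eq (addrI i)).
have i2 : i + 2%:R != i by rewrite -[X in _ != X]addr0 (inj_eq (addrI i)).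
have i12 : i + 1 != i + 2%:R by rewrite (inj_eq (addrI i)).
move: (i + 1) (i + 2%:R) i1 i2 i12 => j k ji ki jk.
have [xk0|xk_neq0] := eqVneq (x 0 k) 0; first exact: hollow_at xk0.
pose y : 'rV[D]_m.+3 := delta_mx 0 j.
(* Chosen so that [x_j - x_k c = 0]: then [x T] vanishes at [j], while [T = 1 - v y] fixes [e_i]. *)
pose c := (x 0 k)^-1 * x 0 j.
pose v : 'cV[D]_m.+3 := delta_mx k 0 *m c%:M.
have yv : y *m v = 0.
  by rewrite mulmxA mul_delta_mx_cond (negPf jk) mul0mx.
pose T := 1%:M + - v *m y; pose T' := 1%:M + v *m y.
have TT' : T *m T' = 1%:M.
  by apply: mul_rank1_mx; rewrite yv mulmx0 addr0 addNr.
have T'T : T' *m T = 1%:M.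
  by apply: mul_rank1_mx; rewrite mulmxN yv oppr0 mulmx0 addr0 addrN.
have xT a : (x *m T) 0 a = x 0 a - x 0 j * (a == j)%:R.
  rewrite mulmxDr mulmx1 mulNmx mulmxN !mulmxA -colE.
  rewrite !mxE big_ord1 !mxE big_ord1 !mxE !eqxx mulr1n /c mulrA.
  by rewrite mulrV ?mul1r //; apply: divD.
have [||X [Y [holX holY defXY]]] := hollow_at j (x *m T) ji.
- by rewrite xT xi0 eq_sym (negPf ji) mulr0 subr0.
- by rewrite xT eqxx mulr1 subrr.
exists (T *m X *m T'), (T *m Y *m T'); split; try exact: hollow_like_conj.
rewrite !mulmxA -(mulmxA _ T' T) T'T mulmx1 -(mulmxA T) -defXY.
rewrite mulmxBr mulmx1 mulmxBl TT' !mulmxA -(mulmxA _ T T') TT' mulmx1.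
by rewrite mulmxDl mul1mx -mulmxA mul_delta_mx_cond (negPf ji) mulmx0 addr0.
Qed.

(** * Factorization into three matrices *)

Lemma hollow_like_prod3 (D : unitRingType) m (M : 'M[D]_m.+3) :
  division_ring D ->
  exists X Y Z,
    [/\ hollow_like X, hollow_like Y, hollow_like Z & M = X *m Y *m Z].
Proof.
move=> divD.
have [[a ->] | [M1 [j [i [simM1 neji M1ji]]]]] := scalar_or_similar_offdiag M.
  (* Entry [(k, k + 1)] of this product is entry [(k, k + 2)] of [a%:M], zero because 2 is nonzero
     modulo [m.+3]. *)
  have [||X [Y [holX holY defXY]]] :=
      @hollow_like_mul2 D m.+2 1 (a%:M *m shift_mx D (- 1)).
  - by [].
  - move=> k; rewrite mul_mx_shift opprK !mxE -addrA.
    by rewrite -[X in X == _]addr0 (inj_eq (addrI k)).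
  exists X, Y, (shift_mx D 1); split=> //; first exact: shift_mx_hollow.
  by rewrite -defXY; apply/matrixP=> k l; rewrite !mul_mx_shift opprK subrK.
have [M2 simM2 colM2] := similar_unit_column divD neji M1ji.
have [S [S' [SS' S'S defM]]] :=
  similar_mx_sym (similar_mx_trans simM1 simM2).
pose x : 'rV[D]_m.+3 := \row_k (- M2 k k).
have xi0 : x 0 i = 0 by rewrite mxE colM2 eqxx oppr0.
have [Y [Z [holY holZ defYZ]]] := transvection_hollow2 divD xi0.
(* For [k != i] the diagonal entry becomes [M2 k k + x_k = 0]. As [x_i = 0], the right factor has
   inverse [1 - e_i x], which is [Y Z]. *)
pose X := M2 *m (1%:M + delta_mx i 0 *m x).
have holX : hollow_like X.
  apply: zero_diag_hollow_like => k.
  rewrite /X mulmxDr mulmx1 mulmxA -colE !mxE big_ord1 !mxE colM2.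
  have [k_i|_] := eqVneq k i; last by rewrite mul1r addrN.
  by rewrite k_i mul0r addr0 colM2 eqxx.
have defM2 : M2 = X *m Y *m Z.
  have xe : x *m (delta_mx i 0 : 'cV_m.+3) = 0.
    by rewrite -colE; apply/matrixP=> k l; rewrite !ord1 mxE xi0 mxE.
  rewrite -mulmxA -defYZ -mulmxA -mulNmx mul_rank1_mx ?mulmx1 //.
  by rewrite mulmxN xe oppr0 mulmx0 addr0 addrN.
exists (S *m X *m S'), (S *m Y *m S'), (S *m Z *m S').
split; try exact: hollow_like_conj.
by rewrite defM defM2 !mulmxA; do 2!rewrite -(mulmxA _ S' S) S'S mulmx1.
Qed.

Lemma hollow_like_pcomm (D : unitRingType) n (p : {poly D}) (M : 'M[D]_n) :
  division_ring D -> infinite_center D -> (forall i, central p`_i) ->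
  (1 < size p)%N -> hollow_like M -> exists A B, M = pcomm p A B.
Proof.
move=> divD infF cp p_gt1 [Z [S [S' [SS' S'S ->]]]].
move=> /(zero_diag_pcomm divD infF cp p_gt1)[A [B ->]].
by rewrite pcomm_conj //; exists (S *m A *m S'), (S *m B *m S').
Qed.

Theorem theorem4p6 (D : unitRingType) (n : nat) (p : {poly D}) :
  division_ring D ->
  infinite_center D ->
  (3 <= n)%N ->
  (forall i : nat, central p`_i) ->
  (1 < size p)%N ->
  forall M : 'M[D]_n,
    exists A1 B1 A2 B2 A3 B3 : 'M[D]_n,
      M = pcomm p A1 B1 *m pcomm p A2 B2 *m pcomm p A3 B3.
Proof.
move=> divD infF n_ge3 cp p_gt1.
case: n n_ge3 => [|[|[|m]]] // _ M.
have [X [Y [Z [holX holY holZ ->]]]] := hollow_like_prod3 M divD.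
have [A1 [B1 ->]] := hollow_like_pcomm divD infF cp p_gt1 holX.
have [A2 [B2 ->]] := hollow_like_pcomm divD infF cp p_gt1 holY.
have [A3 [B3 ->]] := hollow_like_pcomm divD infF cp p_gt1 holZ.
by exists A1, B1, A2, B2, A3, B3.
Qed.
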